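(* Let $\gamma\in(0,1)$, and for $\mathbf A\in\mathbb R^{p\times p}$ let $$\varphi^f_{\mathbf A}(z_1,x_2)=-\mathbf V_{\theta^*}^{-1}\big[\nabla m_{\theta^*}(z_1)-\mathbf A\nabla m^f_{\theta^*}(x_1)+\mathbf A\nabla m^f_{\theta^*}(x_2)\big],\qquad z_1=(x_1,y_1).$$ Let $$\mathbf A^*=\gamma\,\mathrm{Cov}[\nabla m_{\theta^*}(Z),\nabla m^f_{\theta^*}(X)]\,\mathrm{Var}[\nabla m^f_{\theta^*}(X)]^{-1}.$$ Then for all $\mathbf A\in\mathbb R^{p\times p}$, $$\big\langle\varphi^f_{\mathbf A}(z_1,x_2),\varphi^f_{\mathbf A}(z_1,x_2)^\top\big\rangle_{\mathcal H}\succeq\big\langle\varphi^f_{\mathbf A^*}(z_1,x_2),\varphi^f_{\mathbf A^*}(z_1,x_2)^\top\big\rangle_{\mathcal H}.$$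
   Context: M-estimation setting: $Z=(X,Y)\sim\mathbb P^*$ on $\mathcal Z=\mathcal X\times\mathcal Y$; $m_\theta(z):\Theta\times\mathcal Z\to\mathbb R$, $\theta^*=\arg\max_\theta\mathbb E[m_\theta(Z)]\in\mathbb R^p$; $\nabla m_{\theta^*}(z)$ is the gradient in $\theta$ at $\theta^*$, with mean zero and finite second moment; $\mathbf V_{\theta^*}=\frac{\partial^2\mathbb E[m_\theta(Z)]}{\partial\theta\partial\theta^\top}\big|_{\theta=\theta^*}$ is the (symmetric) Hessian, assumed invertible. It is assumed that the M-estimator is regular and asymptotically linear with influence function $-\mathbf V_{\theta^*}^{-1}\nabla m_{\theta^*}(z)$. $f:\mathcal X\to\mathcal Y$ is a fixed prediction function (trained on independent data) and $\nabla m^f_{\theta^*}(x)=\nabla m_{\theta^*}(x,f(x))$, which has finite second moment and non-singular variance under $\mathbb P_X^*$. $\gamma$ is the limiting proportion of unlabeled data. $\mathcal H$ is the Hilbert space of functions $h(z_1)+\frac\gamma{1-\gamma}g(x_2)$ with $h$, $g$ square integrable and mean zero under $\mathbb P^*$, $\mathbb P_X^*$ respectively, with $$\Big\langle h_1(z_1)+\tfrac{\gamma}{1-\gamma}g_1(x_2),\ h_2(z_1)^\top+\tfrac{\gamma}{1-\gamma}g_2(x_2)^\top\Big\rangle_{\mathcal H}=\mathbb E[h_1(Z)h_2(Z)^\top]+\tfrac{\gamma}{1-\gamma}\mathbb E[g_1(X)g_2(X)^\top].$$ $\varphi^f_{\mathbf A}$ is viewed as an element of $\mathcal H$ by centering $\nabla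 m^f_{\theta^*}$ (the constants cancel between the $x_1$ and $x_2$ terms), so that $$\langle\varphi^f_{\mathbf A},(\varphi^f_{\mathbf A})^\top\rangle_{\mathcal H}=\mathbf V_{\theta^*}^{-1}\Big\{\mathrm{Var}[\nabla m_{\theta^*}(Z)-\mathbf A\nabla m^f_{\theta^*}(X)]+\tfrac{1-\gamma}{\gamma}\mathrm{Var}[\mathbf A\nabla m^f_{\theta^*}(X)]\Big\}\mathbf V_{\theta^*}^{-1}.$$ $A\succeq B$ means $A-B$ is positive semidefinite; $\mathrm{Cov}[U,V]=\mathbb E[(U-\mathbb EU)(V-\mathbb EV)^\top]$. *)

(* Defs.v *)
From HB Require Import structures.
From mathcomp Require Import all_boot all_order all_algebra.
From mathcomp Require Import all_classical all_reals all_analysis.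

Set Implicit Arguments.
Unset Strict Implicit.
Unset Printing Implicit Defensive.

Import Order.TTheory GRing.Theory Num.Theory.
Import numFieldNormedType.Exports.
Local Open Scope classical_set_scope.
Local Open Scope ring_scope.

Section loewner.
Context {R : realType} {p : nat}.

Definition psd (A : 'M[R]_p) :=
  A^T = A /\ forall v : 'cV[R]_p, 0 <= (v^T *m A *m v) 0 0.

Definition loewner_ge (A B : 'M[R]_p) := psd (A - B).

End loewner.

Section calculus.
Context {R : realType} {p : nat}.

Definition grad (F : 'cV[R]_p -> R) (t : 'cV[R]_p) : 'cV[R]_p :=
  \col_i 'D_(delta_mx i 0) F t.

Definition hessian (F : 'cV[R]_p -> R) (t : 'cV[R]_p) : 'M[R]_p :=
  \matrix_(i, j) 'D_(delta_mx i 0) (fun s => 'D_(delta_mx j 0) F s) t.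

Definition twice_differentiable (F : 'cV[R]_p -> R) (t : 'cV[R]_p) :=
  (\forall s \near t, differentiable F s) /\ differentiable (grad F) t.

End calculus.

Section moments.
Context {R : realType} {d : measure_display} {T : measurableType d}.
Variables (P : probability T R) (p : nat).
Implicit Types U W : T -> 'cV[R]_p.

Definition entry U (i : 'I_p) : T -> R := fun w => U w i 0.

(* Membership in [Lfun] includes measurability. *)
Definition finite_second_moment U := forall i, entry U i \in Lfun P 2%:E.

Definition mean_zero U := forall i, 'E_P[entry U i]%E = 0%E.

Definition Cov U W : 'M[R]_p :=
  \matrix_(i, j) fine (covariance P (entry U i) (entry W j)).

Definition Var U : 'M[R]_p := Cov U U.

End moments.

Section marginal.
Context {R : realType} {dX dY : measure_display}.
Context {X : measurableType dX} {Y : measurableType dY}.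

HB.instance Definition _ :=
  @isMeasurableFun.Build _ _ (X * Y)%type X fst measurable_fst.

Definition marginalX (P : probability (X * Y)%type R) : probability X R :=
  distribution P (fst : {mfun (X * Y)%type >-> X}).

End marginal.

Section hilbert_space_H.
Context {R : realType} {dX dY : measure_display}.
Context {X : measurableType dX} {Y : measurableType dY}.
Variables (P : probability (X * Y)%type R) (gamma : R).

Let PX : probability X R := marginalX P.

Definition L2_0 d (T : measurableType d) (Q : probability T R) : set (T -> R) :=
  [set h | h \in Lfun Q 2%:E /\ 'E_Q[h]%E = 0%E].

Definition H_fun (u : (X * Y -> R) * (X -> R)) : (X * Y) * X -> R :=
  fun w => u.1 w.1 + gamma / (1 - gamma) * u.2 w.2.

Definition H_decomp (F : (X * Y) * X -> R) : set ((X * Y -> R) * (X -> R)) :=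
  [set u | [/\ L2_0 P u.1, L2_0 PX u.2 & F = H_fun u]].

Definition spaceH : set ((X * Y) * X -> R) := [set F | exists u, H_decomp F u].

(* The mean-zero constraints make the pair (h, g) representing an element of H
   unique (lemma H_decomp_unique), so that this choice is determined on H and
   the inner product is the expected expression (lemma H_innerE); outside H the
   value is irrelevant. *)
Definition H_parts (F : (X * Y) * X -> R) : (X * Y -> R) * (X -> R) :=
  xget (cst 0, cst 0) (H_decomp F).

Definition H_inner (F G : (X * Y) * X -> R) : R :=
  let u := H_parts F in let v := H_parts G in
  fine 'E_P[u.1 \* v.1]%E + gamma / (1 - gamma) * fine 'E_PX[u.2 \* v.2]%E.

(* < Phi, Psi^T >_H for vectors Phi, Psi of elements of H *)
Definition H_inner_mx p (Phi Psi : (X * Y) * X -> 'cV[R]_p) : 'M[R]_p :=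
  \matrix_(i, j) H_inner (fun w => Phi w i 0) (fun w => Psi w j 0).

Lemma L2_0_shift d (T : measurableType d) (Q : probability T R)
    (h k : T -> R) (c : R) :
  L2_0 Q h -> L2_0 Q k -> (forall t, h t = k t + c) -> h = k.
Proof.
move=> [_ h0] [k2 k0] hk.
have k1 : k \in Lfun Q 1.
  by apply: (Lfun_subset12 _ k2); exact: fin_num_measure.
have hE : h = (k \+ cst c)%R by apply/funext => t; rewrite hk.
have c0 : c = 0.
  move: h0; rewrite hE expectationD ?Lfun_cst// k0 add0e expectation_cst.
  by case.
by apply/funext => t; rewrite hk c0 addr0.
Qed.

Lemma H_decomp_unique (F : (X * Y) * X -> R) (u v : (X * Y -> R) * (X -> R)) :
  0 < gamma < 1 -> H_decomp F u -> H_decomp F v -> u = v.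
Proof.
move=> /andP[g0 g1] [u1 u2 Fu] [v1 v2 Fv].
have c0 : gamma / (1 - gamma) != 0.
  by rewrite mulf_neq0 ?invr_neq0 ?gt_eqF// subr_gt0.
have [z0 _] : exists z : X * Y, True.
  apply: contrapT => nz; have := @probability_setT _ _ _ P.
  rewrite (_ : setT = set0) ?measure0; last first.
    by apply/seteqP; split => // z _; apply: nz; exists z.
  by move=> /eqP; rewrite eq_sym onee_eq0.
have E z x : u.1 z + gamma / (1 - gamma) * u.2 x
           = v.1 z + gamma / (1 - gamma) * v.2 x.
  by have := congr1 (fun G => G (z, x)) (etrans (esym Fu) Fv).
have E1 : u.1 = v.1.
  apply: (@L2_0_shift _ _ P _ _
    (gamma / (1 - gamma) * v.2 z0.1 - gamma / (1 - gamma) * u.2 z0.1)) => // z.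
  by have := E z z0.1 => /(canRL (addrK _)) ->; rewrite addrA.
have E2 : u.2 = v.2.
  apply/funext => x; have := E z0 x; rewrite E1 => /addrI.
  exact: (mulfI c0).
by case: u v E1 E2 {u1 u2 Fu v1 v2 Fv E} => [a b] [a' b'] /= -> ->.
Qed.

Lemma H_innerE (h1 h2 : X * Y -> R) (g1 g2 : X -> R) :
  0 < gamma < 1 ->
  L2_0 P h1 -> L2_0 P h2 -> L2_0 PX g1 -> L2_0 PX g2 ->
  H_inner (H_fun (h1, g1)) (H_fun (h2, g2)) =
  fine 'E_P[h1 \* h2]%E + gamma / (1 - gamma) * fine 'E_PX[g1 \* g2]%E.
Proof.
move=> g01 h1P h2P g1P g2P.
have parts h g : L2_0 P h -> L2_0 PX g -> H_parts (H_fun (h, g)) = (h, g).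
  move=> hP gP; apply: xget_unique => [|v Hv]; first by split.
  by apply: (H_decomp_unique g01 Hv); split.
by rewrite /H_inner !parts.
Qed.

End hilbert_space_H.

Section m_estimation.
Context {R : realType} {dX dY : measure_display}.
Context {X : measurableType dX} {Y : measurableType dY}.
Variables (P : probability (X * Y)%type R) (p : nat).
Variables (m : 'cV[R]_p -> X * Y -> R) (theta : 'cV[R]_p) (f : X -> Y).

Definition objective (t : 'cV[R]_p) : R := fine 'E_P[m t]%E.

Definition argmax (Theta : set 'cV[R]_p) : set 'cV[R]_p :=
  [set t | Theta t /\ forall s, Theta s -> objective s <= objective t].

Definition grad_m (z : X * Y) : 'cV[R]_p := grad (fun t => m t z) theta.

Definition grad_mf (x : X) : 'cV[R]_p := grad_m (x, f x).

Definition Vmx : 'M[R]_p := hessian objective theta.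

Definition phi (A : 'M[R]_p) (w : (X * Y) * X) : 'cV[R]_p :=
  - (invmx Vmx *m (grad_m w.1 - A *m grad_mf w.1.1 + A *m grad_mf w.2)).

Definition Astar (gamma : R) : 'M[R]_p :=
  gamma *: (Cov P grad_m (grad_mf \o fst)
            *m invmx (Var (marginalX P) grad_mf)).

End m_estimation.

Section L2_0_closure.
Context {R : realType} {d : measure_display} {T : measurableType d}.
Variable Q : probability T R.

Lemma Lfun2_1 (h : T -> R) : h \in Lfun Q 2%:E -> h \in Lfun Q 1.
Proof. by move=> h2; apply: (Lfun_subset12 _ h2); exact: fin_num_measure. Qed.

Lemma L2_0_cst0 : L2_0 Q (cst 0).
Proof. by split; [exact: Lfun_cst | exact: expectation_cst]. Qed.

Lemma L2_0D (h k : T -> R) : L2_0 Q h -> L2_0 Q k -> L2_0 Q (h \+ k)%R.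
Proof.
move=> [h2 h0] [k2 k0]; split.
  have [_ HD] := Lfun_addr_closed Q (ler1n (Real.sort R) 2 : (1%:E <= 2%:E)%E).
  exact: HD.
by rewrite expectationD ?Lfun2_1// h0 k0 adde0.
Qed.

Lemma L2_0Z (a : R) (h : T -> R) : L2_0 Q h -> L2_0 Q (fun t => a * h t).
Proof.
move=> [h2 h0].
have -> : (fun t => a * h t) = a \o* h by apply/funext => t; rewrite mulrC.
split; first by apply: Lfun_scale => //; rewrite ler1n.
by rewrite expectationZl ?Lfun2_1// h0 mule0.
Qed.

Lemma L2_0_mulmx p (B : 'M[R]_p) (U : T -> 'cV[R]_p) :
  (forall i, L2_0 Q (entry U i)) ->
  forall i, L2_0 Q (entry (fun t => B *m U t) i).
Proof.
move=> UL i.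
suff K (r : seq 'I_p) : L2_0 Q (fun t => \sum_(j <- r) B i j * entry U j t).
  rewrite (_ : entry _ i = (fun t => \sum_j B i j * entry U j t)); first exact: K.
  by apply/funext => t; rewrite /entry mxE.
elim: r => [|j r IH].
  rewrite (_ : (fun _ => _) = cst 0); first exact: L2_0_cst0.
  by apply/funext => t; rewrite big_nil.
rewrite (_ : (fun _ => _) = ((fun t => B i j * entry U j t)
    \+ (fun t => \sum_(k <- r) B i k * entry U k t))%R).
  by apply: L2_0D => //; exact: L2_0Z.
by apply/funext => t; rewrite big_cons.
Qed.

Definition centered p (U : T -> 'cV[R]_p) (t : T) : 'cV[R]_p :=
  U t - \col_i fine 'E_Q[entry U i]%E.

Lemma L2_0_centered p (U : T -> 'cV[R]_p) :
  finite_second_moment Q U -> forall i, L2_0 Q (entry (centered U) i).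
Proof.
move=> U2 i.
have -> : entry (centered U) i =
    (entry U i \+ cst (- fine 'E_Q[entry U i]%E))%R.
  by apply/funext => t; rewrite /entry /centered !mxE.
split.
  have [_ HD] := Lfun_addr_closed Q (ler1n (Real.sort R) 2 : (1%:E <= 2%:E)%E).
  by apply: HD => //; exact: Lfun_cst.
rewrite expectationD ?Lfun2_1 ?Lfun_cst// expectation_cst.
rewrite EFinN fineK ?subee//; exact/expectation_fin_num/Lfun2_1.
Qed.

End L2_0_closure.

Section phi_in_H.
Context {R : realType} {dX dY : measure_display}.
Context {X : measurableType dX} {Y : measurableType dY}.
Variable P : probability (X * Y)%type R.

Lemma L2_0_fst (g : X -> R) : L2_0 (marginalX P) g -> L2_0 P (g \o fst).
Proof.
move=> [g2 g0].
have mg : measurable_fun setT g by move: g2; rewrite inE => /andP[/[!inE]].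
have mgf : measurable_fun setT (g \o @fst X Y).
  by apply: (measurableT_comp mg); exact: measurable_fst.
have gf2 : g \o fst \in Lfun P 2%:E.
  rewrite inE; apply/andP; split; rewrite inE//=.
  move: g2; rewrite inE => /andP[_]; rewrite inE/= /finite_norm unlock.
  rewrite (@ge0_integral_distribution _ _ _ _ _ P) //; last first.
    by move=> y; exact: poweR_ge0.
  apply/measurable_realfun.measurable_EFinP.
  by apply: (@measurableT_comp _ _ _ _ _ _ (fun x : R => x `^ 2)%R) => //;
    exact/measurableT_comp.
split=> //; rewrite -[RHS]g0 unlock.
rewrite (@integral_distribution _ _ _ _ _ P) //; first exact/measurable_realfun.measurable_EFinP.
exact/Lfun1_integrable/Lfun2_1.
Qed.

(* phi_A lies in H: the centering constants of its x_1 and x_2 terms cancel. *)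
Lemma phi_in_H p (m : 'cV[R]_p -> X * Y -> R) (theta : 'cV[R]_p)
    (f : X -> Y) (gamma : R) (A : 'M[R]_p) :
  0 < gamma < 1 ->
  mean_zero P (grad_m m theta) ->
  finite_second_moment P (grad_m m theta) ->
  finite_second_moment (marginalX P) (grad_mf m theta f) ->
  forall i, spaceH P gamma (fun w => phi P m theta f A w i 0).
Proof.
move=> /andP[g0 g1] m0 m2 f2 i.
pose V' := invmx (Vmx P m theta).
pose c := centered (marginalX P) (grad_mf m theta f).
have cL := L2_0_centered f2; rewrite -/c in cL.
have gN0 : gamma != 0 by rewrite gt_eqF.
have g1N0 : 1 - gamma != 0 by rewrite gt_eqF// subr_gt0.
pose k := gamma / (1 - gamma).
have kN0 : k != 0 by rewrite mulf_neq0 ?invr_neq0.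
exists (fun z => entry (fun z => - V' *m grad_m m theta z) i z
          + entry (fun z => (V' *m A) *m c z.1) i z,
   fun x => k^-1 * entry (fun x => - (V' *m A) *m c x) i x); split => /=.
- apply: L2_0D; apply: L2_0_mulmx => j; first by split; [exact: m2|exact: m0].
  exact: (L2_0_fst (cL j)).
- by apply: L2_0Z; exact: L2_0_mulmx.
- apply/funext => -[z x]; rewrite /H_fun/= -/k mulrA divff// mul1r.
  rewrite /entry/= /c /centered !mulNmx !mulmxBr -!mulmxA.
  rewrite /phi /= -/V' mulmxDr mulmxBr !mxE.
  set a := (\sum_j _); set b := (\sum_j _); set e := (\sum_j _); set h := (\sum_j _).
  rewrite !opprD !opprK -!addrA; congr (_ + (_ + _)).
  by rewrite addrCA addNr addr0.
Qed.

End phi_in_H.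

(* Main.v *)
(* Write G for the gradient at theta, c for its centered imputed version,
   C = E[G c^T], S = Var[c] and B = -V^-1.  The Gram matrix of phi_A in H is
   B (E[G G^T] - C A^T - A C^T + gamma^-1 A S A^T) B^T, because the coefficient
   of A S A^T is 1 + (1 - gamma) / gamma.  The optimal A0 satisfies
   A0 S = gamma C, so completing the square makes the difference between the
   Gram matrices at A and A0 equal to gamma^-1 D S D^T with D = B (A - A0),
   which is positive semidefinite. *)

Require Import Defs.
From HB Require Import structures.
From mathcomp Require Import all_boot all_order all_algebra.
From mathcomp Require Import all_classical all_reals all_analysis.
From mathcomp Require Import ring.

Set Implicit Arguments.
Unset Strict Implicit.
Unset Printing Implicit Defensive.

Import Order.TTheory GRing.Theory Num.Theory.
Import numFieldNormedType.Exports.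
Local Open Scope classical_set_scope.
Local Open Scope ring_scope.

(** * Uncentered second-moment matrices and their bilinearity *)

Section cross_moment.
Context {R : realType} {d : measure_display} {T : measurableType d}.
Variable Q : probability T R.

Lemma Lfun2_lin_comb (I : Type) (r : seq I) (a : I -> R) (F : I -> T -> R) :
  (forall j, F j \in Lfun Q 2%:E) ->
  (fun t => \sum_(j <- r) a j * F j t) \in Lfun Q 2%:E.
Proof.
move=> FL; elim: r => [|j r IH].
  rewrite (_ : (fun _ => _) = cst 0); first exact: Lfun_cst.
  by apply/funext => t; rewrite big_nil.
have [_ HD] := Lfun_addr_closed Q (ler1n R 2 : (1%:E <= 2%:E)%E).
rewrite (_ : (fun _ => _) =
  (a j \o* F j) \+ (fun t => \sum_(k <- r) a k * F k t)); last first.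
  by apply/funext => t; rewrite big_cons/= mulrC.
by apply: HD => //; apply: Lfun_scale; rewrite ?ler1n.
Qed.

(** Products of two square-integrable functions are integrable, so every expectation met in the
    induction is finite and [fine] commutes with sums and scalings. This is what lets a constant
    matrix be pulled out of a second-moment matrix. *)
Lemma fine_expectation_lin_comb (I : Type) (r : seq I) (a : I -> R)
    (F : I -> T -> R) (W : T -> R) :
  (forall j, F j \in Lfun Q 2%:E) -> W \in Lfun Q 2%:E ->
  fine 'E_Q[((fun t => \sum_(j <- r) a j * F j t) \* W)%R]%E =
  \sum_(j <- r) a j * fine 'E_Q[F j \* W]%E.
Proof.
move=> FL WL; elim: r => [|j r IH].
  rewrite big_nil (_ : _ \* _ = cst 0) ?expectation_cst//.
  by apply/funext => t; rewrite /= big_nil mul0r.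
rewrite big_cons -IH.
have FW1 : F j \* W \in Lfun Q 1 by exact: Lfun2_mul_Lfun1.
have SW1 : (fun t => \sum_(k <- r) a k * F k t) \* W \in Lfun Q 1.
  by apply: Lfun2_mul_Lfun1 => //; exact: Lfun2_lin_comb.
rewrite (_ : _ \* _ = (a j \o* (F j \* W)) \+
    ((fun t => \sum_(k <- r) a k * F k t) \* W)); last first.
  by apply/funext => t; rewrite /= big_cons mulrDl -mulrA [X in X + _]mulrC.
rewrite expectationD ?expectationZl//; last first.
  by apply: Lfun_scale.
rewrite fineD ?fineM ?fin_numM ?expectation_fin_num//.
Qed.

(** Left uncentered, like the inner product of H. The two dimensions are independent so that a row
    vector can be applied to [U]: the quadratic form of E[U U^T] at v is then the 1 by 1 cross
    moment of v^T U with itself. *)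
Definition cross_moment p q (U : T -> 'cV[R]_p) (W : T -> 'cV[R]_q) :
    'M[R]_(p, q) :=
  \matrix_(i, j) fine 'E_Q[entry U i \* entry W j]%E.

Lemma finite_second_momentD p (U W : T -> 'cV[R]_p) :
  finite_second_moment Q U -> finite_second_moment Q W ->
  finite_second_moment Q (fun t => U t + W t).
Proof.
move=> UL WL i.
have [_ HD] := Lfun_addr_closed Q (ler1n R 2 : (1%:E <= 2%:E)%E).
rewrite (_ : entry _ i = entry U i \+ entry W i); first exact: HD.
by apply/funext => t; rewrite /entry mxE.
Qed.

Lemma entry_mulmx p q (B : 'M[R]_(q, p)) (U : T -> 'cV[R]_p) i :
  entry (fun t => B *m U t) i = (fun t => \sum_j B i j * entry U j t).
Proof. by apply/funext => t; rewrite /entry mxE. Qed.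

Lemma finite_second_moment_mulmx p q (B : 'M[R]_(q, p)) (U : T -> 'cV[R]_p) :
  finite_second_moment Q U -> finite_second_moment Q (fun t => B *m U t).
Proof. by move=> UL i; rewrite entry_mulmx; exact: Lfun2_lin_comb. Qed.

Lemma cross_moment_tr p q (U : T -> 'cV[R]_p) (W : T -> 'cV[R]_q) :
  (cross_moment U W)^T = cross_moment W U.
Proof.
apply/matrixP => i j; rewrite !mxE; congr (fine 'E_Q[_]%E).
by apply/funext => t /=; rewrite mulrC.
Qed.

Lemma cross_moment_mulmxl p q r (B : 'M[R]_(r, p)) (U : T -> 'cV[R]_p)
    (W : T -> 'cV[R]_q) :
  finite_second_moment Q U -> finite_second_moment Q W ->
  cross_moment (fun t => B *m U t) W = B *m cross_moment U W.
Proof.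
move=> UL WL; apply/matrixP => i j; rewrite !mxE entry_mulmx.
by rewrite fine_expectation_lin_comb//; apply: eq_bigr => k _; rewrite mxE.
Qed.

Lemma cross_moment_mulmxr p q r (B : 'M[R]_(r, q)) (U : T -> 'cV[R]_p)
    (W : T -> 'cV[R]_q) :
  finite_second_moment Q U -> finite_second_moment Q W ->
  cross_moment U (fun t => B *m W t) = cross_moment U W *m B^T.
Proof.
move=> UL WL; rewrite -cross_moment_tr cross_moment_mulmxl//.
by rewrite trmx_mul cross_moment_tr.
Qed.

Lemma cross_momentDl p q (U1 U2 : T -> 'cV[R]_p) (W : T -> 'cV[R]_q) :
  finite_second_moment Q U1 -> finite_second_moment Q U2 ->
  finite_second_moment Q W ->
  cross_moment (fun t => U1 t + U2 t) W =
  cross_moment U1 W + cross_moment U2 W.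
Proof.
move=> U1L U2L WL; apply/matrixP => i j; rewrite !mxE.
have M1 U : finite_second_moment Q U -> entry U i \* entry W j \in Lfun Q 1.
  by move=> UL; exact: Lfun2_mul_Lfun1.
rewrite -fineD ?expectation_fin_num ?M1// -expectationD ?M1//.
congr (fine 'E_Q[_]%E).
by apply/funext => t; rewrite /entry/= mxE mulrDl.
Qed.

Lemma cross_momentDr p q (U : T -> 'cV[R]_p) (W1 W2 : T -> 'cV[R]_q) :
  finite_second_moment Q U -> finite_second_moment Q W1 ->
  finite_second_moment Q W2 ->
  cross_moment U (fun t => W1 t + W2 t) =
  cross_moment U W1 + cross_moment U W2.
Proof.
move=> UL W1L W2L; rewrite -cross_moment_tr cross_momentDl// linearD /=.
by rewrite !cross_moment_tr.
Qed.

(* v^T E[U U^T] v = E[(v^T U)^2] *)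
Lemma psd_cross_moment p (U : T -> 'cV[R]_p) :
  finite_second_moment Q U -> psd (cross_moment U U).
Proof.
move=> UL; split; first exact: cross_moment_tr.
move=> v; have vUL := finite_second_moment_mulmx v^T UL.
rewrite -cross_moment_mulmxl// -{2}(trmxK v) -cross_moment_mulmxr// mxE.
by apply/fine_ge0/expectation_ge0 => t; rewrite /= -expr2 sqr_ge0.
Qed.

Lemma Var_cross_moment p (U : T -> 'cV[R]_p) :
  Var Q U = cross_moment (centered Q U) (centered Q U).
Proof.
apply/matrixP => i j; rewrite !mxE covariance.unlock; congr (fine 'E_Q[_]%E).
by apply/funext => t; rewrite /entry/= !mxE.
Qed.

End cross_moment.

(** * Stability of positive semidefiniteness under congruence and nonnegative scaling *)

Lemma psd_congr (R : realType) p q (B : 'M[R]_(q, p)) (S : 'M[R]_p) :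
  psd S -> psd (B *m S *m B^T).
Proof.
move=> [ST S0]; split; first by rewrite !trmx_mul trmxK ST mulmxA.
(* The quadratic form of B S B^T at v is that of S at B^T v. *)
by move=> v; have := S0 (B^T *m v); rewrite trmx_mul trmxK !mulmxA.
Qed.

Lemma psdZ (R : realType) p (a : R) (S : 'M[R]_p) :
  0 <= a -> psd S -> psd (a *: S).
Proof.
move=> a0 [ST S0]; split; first by rewrite linearZ /= ST.
by move=> v; rewrite -scalemxAr -scalemxAl mxE mulr_ge0.
Qed.

(** * Transfer of moments between the joint law and its marginal on [X] *)

Section marginal_moments.
Context {R : realType} {dX dY : measure_display}.
Context {X : measurableType dX} {Y : measurableType dY}.
Variable P : probability (X * Y)%type R.

Lemma expectation_fst (g : X -> R) :
  g \in Lfun (marginalX P) 1 -> g \o fst \in Lfun P 1 ->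
  'E_P[g \o fst]%E = 'E_(marginalX P)[g]%E.
Proof.
move=> g1 gf1; rewrite unlock (@integral_distribution _ _ _ _ _ P)//.
  apply/measurable_realfun.measurable_EFinP.
  by move: g1; rewrite inE => /andP[/[!inE]].
exact/Lfun1_integrable.
Qed.

(** Needed because the x_1 term of the influence function is integrated under [P] and the x_2 term
    under the marginal: both must produce the same variance matrix for their coefficients to add
    up. *)
Lemma cross_moment_fst p (c : X -> 'cV[R]_p) :
  (forall i, L2_0 (marginalX P) (entry c i)) ->
  cross_moment P (c \o fst) (c \o fst) = cross_moment (marginalX P) c c.
Proof.
move=> cL; apply/matrixP => i j; rewrite !mxE; congr fine.
rewrite -[RHS]expectation_fst//; apply: Lfun2_mul_Lfun1.
- by have [] := cL i.
- by have [] := cL j.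
- by have [] := L2_0_fst (cL i).
- by have [] := L2_0_fst (cL j).
Qed.

(** Since [G] has mean zero, only the second factor is centered in the covariance, and its mean
    under [P] agrees with its mean under the marginal. *)
Lemma Cov_fst_cross_moment p (G : X * Y -> 'cV[R]_p) (c : X -> 'cV[R]_p) :
  mean_zero P G -> finite_second_moment (marginalX P) c ->
  Cov P G (c \o fst) = cross_moment P G (centered (marginalX P) c \o fst).
Proof.
move=> G0 cL; apply/matrixP => i j; rewrite !mxE covariance.unlock G0.
suff -> : 'E_P[entry (c \o fst) j]%E = 'E_(marginalX P)[entry c j]%E.
  congr (fine 'E_P[_]%E); apply/funext => t.
  by rewrite /entry/= !mxE -[X in _ = X * _]subr0.
rewrite -[RHS]expectation_fst//; first exact/Lfun2_1/cL.
(* What remains is integrability of [c] composed with [fst]. [L2_0_fst] covers mean-zero functions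
   only, so it is applied to the centered entry and the constant [e] is added back. *)
pose e := fine 'E_(marginalX P)[entry c j]%E.
have [/Lfun2_1 cf1 _] := L2_0_fst (L2_0_centered cL j).
rewrite (_ : _ \o _ =
    (entry (centered (marginalX P) c) j \o fst) \+ cst e); last first.
  by apply/funext => t; rewrite /entry/= !mxE subrK.
have [_ HD] := Lfun_addr_closed P (lexx 1%E).
by apply: HD => //; exact: Lfun_cst.
Qed.

End marginal_moments.

(** * The Gram matrix of the influence function in H, and its minimization *)

Section efficiency.
Context {R : realType} {dX dY : measure_display}.
Context {X : measurableType dX} {Y : measurableType dY}.
Variable P : probability (X * Y)%type R.
Variables (p : nat) (m : 'cV[R]_p -> X * Y -> R) (theta : 'cV[R]_p).
Variables (f : X -> Y) (gamma : R).
Hypothesis g01 : 0 < gamma < 1.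
Hypothesis m0 : mean_zero P (grad_m m theta).
Hypothesis m2 : finite_second_moment P (grad_m m theta).
Hypothesis f2 : finite_second_moment (marginalX P) (grad_mf m theta f).

Let G := grad_m m theta.
Let c := centered (marginalX P) (grad_mf m theta f).
Let B := - invmx (Vmx P m theta).
Let k := gamma / (1 - gamma).

Let cL : forall i, L2_0 (marginalX P) (entry c i).
Proof. exact: L2_0_centered. Qed.

Let gamma_neq0 : gamma != 0.
Proof. by case/andP: g01 => g0 _; rewrite gt_eqF. Qed.

Let subr_gamma_neq0 : 1 - gamma != 0.
Proof. by case/andP: g01 => _ g1; rewrite gt_eqF// subr_gt0. Qed.

Let k_neq0 : k != 0.
Proof. by rewrite mulf_neq0 ?invr_neq0. Qed.

(** [h] and [g] are the labeled and unlabeled components of phi_A in H. They use the centered [c] so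
    as to have mean zero, and the factor k^-1 in [g] offsets the weight k that [H_fun] puts on its
    second component. *)
Let h (A : 'M[R]_p) (z : X * Y) := B *m G z + - (B *m A) *m (c \o fst) z.
Let g (A : 'M[R]_p) (x : X) := (k^-1 *: (B *m A)) *m c x.

Lemma phi_decomp (A : 'M[R]_p) i :
  (fun w => phi P m theta f A w i 0) =
  H_fun gamma (entry (h A) i, entry (g A) i).
Proof.
apply/funext => -[z x]; rewrite /H_fun/= -/k /entry /phi/=.
(* The scalar identity is read as entry [i] of a vector identity, so that matrix algebra applies. *)
have -> (a b : 'cV[R]_p) :
    a i 0 + k * b i 0 = (a + k *: b : 'cV[R]_p) i 0 by rewrite !mxE.
congr (fun_of_matrix _ i 0).
rewrite /h /g -scalemxAl scalerA divff// scale1r -/G /B /=.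
rewrite -mulNmx mulmxDr mulmxBr /c /centered !(mulmxBr, mulNmx, mulmxA).
rewrite !(opprD, opprK) -!addrA; congr (_ + (_ + _)).
(* The mean of the imputed gradient enters the x_1 and x_2 terms with opposite signs and cancels. *)
by rewrite addrCA addNr addr0.
Qed.

Lemma h_L2_0 (A : 'M[R]_p) i : L2_0 P (entry (h A) i).
Proof.
rewrite (_ : entry _ i = entry (fun z => B *m G z) i
    \+ entry (fun z => - (B *m A) *m (c \o fst) z) i); last first.
  by apply/funext => z; rewrite /entry/= /h mxE.
apply: L2_0D; apply: L2_0_mulmx => j; first by split; [exact: m2|exact: m0].
exact: (L2_0_fst (cL j)).
Qed.

Lemma g_L2_0 (A : 'M[R]_p) i : L2_0 (marginalX P) (entry (g A) i).
Proof. exact: L2_0_mulmx. Qed.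

Let S := Var (marginalX P) (grad_mf m theta f).
Let C := Cov P G (grad_mf m theta f \o fst).

Lemma H_inner_mx_phi (A : 'M[R]_p) :
  H_inner_mx P gamma (phi P m theta f A) (phi P m theta f A) =
  B *m (cross_moment P G G - C *m A^T - A *m C^T
        + gamma^-1 *: (A *m S *m A^T)) *m B^T.
Proof.
(* [H_innerE] evaluates the inner product on the components [h A] and [g A], which are the only ones
   representing phi_A. *)
have -> : H_inner_mx P gamma (phi P m theta f A) (phi P m theta f A) =
    cross_moment P (h A) (h A) + k *: cross_moment (marginalX P) (g A) (g A).
  apply/matrixP => i j; rewrite !mxE !phi_decomp H_innerE//;
    by [exact: h_L2_0|exact: g_L2_0].
have c2 : finite_second_moment (marginalX P) c by move=> i; have [] := cL i.
have cf2 : finite_second_moment P (c \o fst).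
  by move=> i; have [] := L2_0_fst (cL i).
have G2 : finite_second_moment P G := m2.
rewrite {1}/g cross_moment_mulmxl//; last exact: finite_second_moment_mulmx.
rewrite cross_moment_mulmxr// -Var_cross_moment -/S.
rewrite /h cross_momentDl ?cross_momentDr//;
  try (by apply: finite_second_moment_mulmx);
  try (by apply: finite_second_momentD; apply: finite_second_moment_mulmx).
rewrite !cross_moment_mulmxl//; try exact: finite_second_moment_mulmx.
rewrite !cross_moment_mulmxr// cross_moment_fst// -Var_cross_moment -/S.
rewrite -[cross_moment P (c \o fst) G]cross_moment_tr.
rewrite -[cross_moment P G (c \o fst)](Cov_fst_cross_moment m0 f2) -/C.
(* [B] is itself defined as an opposite; generalizing it keeps the sign rules below from reaching
   inside. *)
rewrite /g /h; generalize B => D; rewrite linearN linearZ /= !trmx_mul.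
rewrite !(mulmxDr, mulmxDl, mulmxN, mulNmx, opprK).
rewrite -!(scalemxAl, scalemxAr) !scalerA divff// mul1r !mulmxA.
(* The summand 1 comes from the x_1 term, and k^-1 = k (k^-1)^2 from the x_2 term. *)
have -> : gamma^-1 = 1 + k^-1 by rewrite /k; field; exact/andP.
by rewrite scalerDl scale1r !addrA.
Qed.

Lemma H_inner_mx_phi_sub (A : 'M[R]_p) (As := Astar P m theta f gamma) :
  S \in unitmx ->
  H_inner_mx P gamma (phi P m theta f A) (phi P m theta f A) -
  H_inner_mx P gamma (phi P m theta f As) (phi P m theta f As) =
  gamma^-1 *: ((B *m (A - As)) *m S *m (B *m (A - As))^T).
Proof.
move=> Su; have AsS : As *m S = gamma *: C.
  by rewrite /As /Astar -scalemxAl mulmxKV.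
(* From here on [As] is known only through the normal equation [AsS], which turns both mixed terms
   into products around [S]; symmetry of [S] handles the transposed one. *)
clearbody As; have CE : C = gamma^-1 *: (As *m S).
  by rewrite AsS scalerA mulVf// scale1r.
have ST : S^T = S by rewrite /S Var_cross_moment cross_moment_tr.
rewrite !H_inner_mx_phi -mulmxBl -mulmxBr trmx_mul.
transitivity (B *m (gamma^-1 *: ((A - As) *m S *m (A - As)^T)) *m B^T);
  last first.
  by rewrite -scalemxAr -scalemxAl !mulmxA.
congr (_ *m _ *m _); rewrite CE linearZ /= trmx_mul ST linearB /=.
rewrite -!scalemxAl -!scalemxAr !mulmxBr !mulmxBl !mulmxA.
(* Both sides are now linear combinations of [W] and four triple products. Naming these as atoms
   reduces the noncommutative identity to a scalar one in each entry. *)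
apply/matrixP => i j.
set W := cross_moment _ _ _.
set AA := A *m S *m A^T; set sA := As *m S *m A^T.
set As' := A *m S *m As^T; set ss := As *m S *m As^T.
by rewrite !mxE; ring.
Qed.

End efficiency.

Theorem propositionC1 (R : realType) (dX dY : measure_display)
  (X : measurableType dX) (Y : measurableType dY)
  (P : probability (X * Y)%type R)
  (p : nat) (Theta : set 'cV[R]_p) (m : 'cV[R]_p -> X * Y -> R)
  (theta : 'cV[R]_p) (f : X -> Y) (gamma : R)
  (m_integrable : forall t, Theta t -> m t \in Lfun P 1)
  (theta_argmax : argmax P m Theta = [set theta])
  (theta_interior : Theta° theta)
  (m_differentiable :
    {ae P, forall z, differentiable (fun t => m t z) theta})
  (grad_m_mean_zero : mean_zero P (grad_m m theta))
  (grad_m_L2 : finite_second_moment P (grad_m m theta))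
  (objective_differentiable : twice_differentiable (objective P m) theta)
  (V_symmetric : (Vmx P m theta)^T = Vmx P m theta)
  (V_invertible : Vmx P m theta \in unitmx)
  (f_measurable : measurable_fun [set: X] f)
  (mf_differentiable :
    {ae marginalX P, forall x, differentiable (fun t => m t (x, f x)) theta})
  (grad_mf_L2 : finite_second_moment (marginalX P) (grad_mf m theta f))
  (Var_grad_mf_invertible :
    Var (marginalX P) (grad_mf m theta f) \in unitmx)
  (gamma_range : 0 < gamma < 1)
  (A : 'M[R]_p) :
  let phi_A := phi P m theta f A in
  let phi_Astar := phi P m theta f (Astar P m theta f gamma) in
  loewner_ge (H_inner_mx P gamma phi_A phi_A)
             (H_inner_mx P gamma phi_Astar phi_Astar).
Proof.
have /andP[g0 _] := gamma_range.
rewrite /loewner_ge /= H_inner_mx_phi_sub//.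
apply: psdZ; first by rewrite invr_ge0 ltW.
(* The middle factor is the variance of the imputed gradient, that is, the second-moment matrix of
   its centered version. *)
apply: psd_congr; rewrite Var_cross_moment; apply: psd_cross_moment => i.
by have [] := L2_0_centered grad_mf_L2 i.
Qed.
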